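(* Let $m,n\ge 1$ be integers. The group $B_{m,n}\le B_{m+n}$ has a presentation with generators the braids $a_{ij}$ for $1\le i\le m$, $m+1\le j\le m+n$, together with $\sigma_{m+1},\sigma_{m+2},\ldots,\sigma_{m+n-1}$, and defining relations the following, for all indices such that every symbol occurring is one of these generators, and for $\varepsilon\in\{+1,-1\}$: \begin{align*} (\Sigma_1)\quad & \sigma_k\sigma_l=\sigma_l\sigma_k && \text{if } |k-l|>1,\\ (\Sigma_2)\quad & \sigma_k\sigma_{k+1}\sigma_k=\sigma_{k+1}\sigma_k\sigma_{k+1} && \text{if } m+1\le k\le m+n-2,\\ (1)\quad & \sigma_k^{-1}a_{ij}^{\varepsilon}\sigma_k=a_{ij}^{\varepsilon} && \text{if } k\le j-2 \text{ or } k\ge j+1,\\ (2)\quad & a_{ij}^{\varepsilon}=\sigma_{j-1}a_{i,j-1}^{\varepsilon}\sigma_{j-1}^{-1}, &&\\ (3)\quad & \sigma_j^{-1}a_{ij}^{\varepsilon}\sigma_j=a_{ij}a_{i,j+1}^{\varepsilon}a_{ij}^{-1}, &&\\ (4)\quad & a_{ij}^{\varepsilon}a_{r,j+1}^{\varepsilon}=a_{r,j+1}^{\varepsilon}a_{ij}^{\varepsilon} && \text{if } r<i. \end{align*}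
   Context: $B_k$ denotes the classical Artin braid group on $k$ strands, with standard generators $\sigma_1,\ldots,\sigma_{k-1}$, relations $\sigma_i\sigma_j=\sigma_j\sigma_i$ for $|i-j|>1$ and $\sigma_i\sigma_{i+1}\sigma_i=\sigma_{i+1}\sigma_i\sigma_{i+1}$, and product given by concatenation. $B_{m,n}\le B_{m+n}$ is the subgroup of all braids on $m+n$ strands such that, if the last $n$ strands are removed, what is left is the identity braid on the first $m$ strands (in particular the first $m$ strands begin and end at the positions $1,\ldots,m$, strand $i$ ending at position $i$). For $1\le i<j\le m+n$, the element $a_{ij}\in B_{m+n}$ is $$a_{ij}=\sigma_i^{-1}\sigma_{i+1}^{-1}\cdots\sigma_{j-2}^{-1}\,\sigma_{j-1}^{2}\,\sigma_{j-2}\cdots\sigma_{i+1}\sigma_i=\sigma_{j-1}\sigma_{j-2}\cdots\sigma_{i+1}\,\sigma_i^{2}\,\sigma_{i+1}^{-1}\cdots\sigma_{j-2}^{-1}\sigma_{j-1}^{-1}.$$ *)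

(* Defs.v *)
From HB Require Import structures.
From mathcomp Require Import all_boot.
From mathcomp Require Import boolp classical_sets.

Set Implicit Arguments.
Unset Strict Implicit.
Unset Printing Implicit Defensive.

Local Open Scope quotient_scope.
Local Open Scope classical_set_scope.
Local Open Scope group_scope.

(* A letter (x, e) stands for x if e = true and for x^-1 if e = false. *)
Definition word (X : Type) := seq (X * bool).

Definition word_inv (X : Type) (w : word X) : word X :=
  rev [seq (l.1, ~~ l.2) | l <- w].

(* The least congruence on words that contains R and free cancellation. *)
Inductive word_eqv (X : Type) (R : word X -> word X -> Prop) :
    word X -> word X -> Prop :=
| word_eqv_rel u v : R u v -> word_eqv R u v
| word_eqv_cancel x e : word_eqv R [:: (x, e); (x, ~~ e)] [::]
| word_eqv_refl u : word_eqv R u u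
| word_eqv_sym u v : word_eqv R u v -> word_eqv R v u
| word_eqv_trans u v w : word_eqv R u v -> word_eqv R v w -> word_eqv R u w
| word_eqv_cat u u' v v' :
    word_eqv R u u' -> word_eqv R v v' -> word_eqv R (u ++ v) (u' ++ v').

Section Presented.
Variables (X : choiceType) (R : word X -> word X -> Prop).

Definition word_eqvb (u v : word X) : bool := `[< word_eqv R u v >].

Lemma word_eqvb_refl : reflexive word_eqvb.
Proof. by move=> u; apply/asboolP; exact: word_eqv_refl. Qed.

Lemma word_eqvb_sym : symmetric word_eqvb.
Proof. by move=> u v; apply/asboolP/asboolP; exact: word_eqv_sym. Qed.

Lemma word_eqvb_trans : transitive word_eqvb.
Proof.
move=> v u w /asboolP uv /asboolP vw.
by apply/asboolP; exact: word_eqv_trans uv vw.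
Qed.

Canonical word_eqvb_equiv :=
  EquivRel word_eqvb word_eqvb_refl word_eqvb_sym word_eqvb_trans.

Definition presented := {eq_quot word_eqvb}.
HB.instance Definition _ := Choice.on presented.
HB.instance Definition _ := EqQuotient.on presented.

Definition word_class (w : word X) : presented := \pi w.

Lemma word_classP u v : word_class u = word_class v <-> word_eqv R u v.
Proof. by split=> [/eqmodP/asboolP//|uv]; apply/eqmodP/asboolP. Qed.

Lemma word_class_repr (x : presented) : word_class (repr x) = x.
Proof. exact: reprK. Qed.

Lemma word_eqv_repr w : word_eqv R (repr (word_class w)) w.
Proof. by apply/word_classP; rewrite word_class_repr. Qed.

Lemma word_inv_cat (u v : word X) :
  word_inv (u ++ v) = word_inv v ++ word_inv u.
Proof. by rewrite /word_inv map_cat rev_cat. Qed.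

Lemma word_invK : involutive (@word_inv X).
Proof.
move=> w; rewrite /word_inv map_rev revK -map_comp.
by rewrite -[RHS]map_id; apply: eq_map => -[x e] /=; rewrite negbK.
Qed.

Lemma word_eqv_catV w : word_eqv R (w ++ word_inv w) [::].
Proof.
elim: w => [|[x e] w IHw]; first exact: word_eqv_refl.
rewrite -cat1s word_inv_cat -catA (catA w).
apply: word_eqv_trans (word_eqv_cancel R x e).
apply: (word_eqv_cat (u := [:: (x, e)]) (u' := [:: (x, e)])).
  exact: word_eqv_refl.
apply: (word_eqv_cat (v := [:: (x, ~~ e)]) (u' := [::]) IHw).
exact: word_eqv_refl.
Qed.

Definition presented_one : presented := word_class [::].
Definition presented_mul (x y : presented) : presented :=
  word_class (repr x ++ repr y).
Definition presented_inv (x : presented) : presented :=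
  word_class (word_inv (repr x)).

Fact presented_mulA : associative presented_mul.
Proof.
move=> x y z; apply/word_classP.
apply: (word_eqv_trans (v := repr x ++ (repr y ++ repr z))).
  by apply: word_eqv_cat (word_eqv_refl _ _) (word_eqv_repr _).
rewrite catA; apply: word_eqv_cat (word_eqv_refl _ _).
exact/word_eqv_sym/word_eqv_repr.
Qed.

Fact presented_1mul : left_id presented_one presented_mul.
Proof.
move=> x; rewrite -[RHS]word_class_repr; apply/word_classP.
exact: word_eqv_cat (word_eqv_repr [::]) (word_eqv_refl _ _).
Qed.

Fact presented_mul1 : right_id presented_one presented_mul.
Proof.
move=> x; rewrite -[RHS]word_class_repr; apply/word_classP.
rewrite -[X in word_eqv _ _ X]cats0.
exact: word_eqv_cat (word_eqv_refl _ _) (word_eqv_repr [::]).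
Qed.

Fact presented_mulV : right_inverse presented_one presented_inv presented_mul.
Proof.
move=> x; apply/word_classP; apply: word_eqv_trans (word_eqv_catV (repr x)).
exact: word_eqv_cat (word_eqv_refl _ _) (word_eqv_repr _).
Qed.

Fact presented_Vmul : left_inverse presented_one presented_inv presented_mul.
Proof.
move=> x; apply/word_classP.
apply: word_eqv_trans (word_eqv_catV (word_inv (repr x))).
by rewrite word_invK; apply: word_eqv_cat (word_eqv_repr _) (word_eqv_refl _ _).
Qed.

HB.instance Definition _ := isGroup.Build presented presented_mulA
  presented_1mul presented_mul1 presented_Vmul presented_mulV.

Definition presented_gen (x : X) : presented := word_class [:: (x, true)].

(* The elements g x generate the subgroup H, with defining relations R: the
   assignment x |-> g x induces an isomorphism from < X | R > onto H. *)
Definition has_presentation (G : groupType) (H : set G) (g : X -> G) : Prop :=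
  exists phi : {multiplicative presented -> G},
    [/\ forall x, phi (presented_gen x) = g x, injective phi & range phi = H].

End Presented.

(* Strands, positions and indices of generators are numbered from 1. *)
Definition braid_gen (k : nat) := {i : nat | 0 < i < k}.
HB.instance Definition _ k := Choice.on (braid_gen k).

Section BraidRel.
Variable k : nat.
Implicit Types s t : braid_gen k.

Inductive braid_rel : word (braid_gen k) -> word (braid_gen k) -> Prop :=
| braid_rel_comm s t :
    ((val s).+1 < val t) || ((val t).+1 < val s) ->
    braid_rel [:: (s, true); (t, true)] [:: (t, true); (s, true)]
| braid_rel_braid s t : val t = (val s).+1 ->
    braid_rel [:: (s, true); (t, true); (s, true)]
              [:: (t, true); (s, true); (t, true)].

End BraidRel.

Definition braid (k : nat) := presented (@braid_rel k).
HB.instance Definition _ k := Group.on (braid k).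

(* [sigma k i] is the Artin generator for 0 < i < k, and 1 otherwise. *)
Definition sigma (k i : nat) : braid k :=
  if insub i is Some s then presented_gen (@braid_rel k) s else 1.

Definition pure_a (k i j : nat) : braid k :=
  (\prod_(i <= l < j.-1) (sigma k l)^-1) * sigma k j.-1 ^+ 2
    * (\prod_(l <- rev (index_iota i j.-1)) sigma k l).

(* Strand removal, on words read from left to right.  K is the set of positions
   occupied by the strands to be kept, before the crossings of the word. *)
Definition swap_positions (i : nat) (K : pred nat) : pred nat :=
  fun p => K (if p == i then i.+1 else if p == i.+1 then i else p).

Fixpoint positions_after k (w : word (braid_gen k)) (K : pred nat) : pred nat :=
  if w is (s, _) :: w' then positions_after w' (swap_positions (val s) K)
  else K.

(* A crossing between positions i and i + 1 survives iff both of its strands are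
   kept; the left one is then the r-th kept strand, where r is the number of
   elements of K in {1, ..., i}.  The result is meaningful if K consists of
   m positions in {1, ..., k}. *)
Fixpoint remove_strands m k (w : word (braid_gen k)) (K : pred nat) : braid m :=
  if w is (s, e) :: w' then
    let i := val s in
    (if K i && K i.+1 then
       let x := sigma m (count K (iota 1 i)) in if e then x else x^-1
     else 1)
    * remove_strands m w' (swap_positions i K)
  else 1.

Definition first_positions (m : nat) : pred nat := fun p => 0 < p <= m.

(* The two conditions do not depend on the word representing the braid: the
   kept strands end at the positions 1, ..., m, and they form the identity
   braid. *)
Definition mixed_braid (m n : nat) : set (braid (m + n)) :=
  [set b | exists w : word (braid_gen (m + n)),
     [/\ b = word_class (@braid_rel (m + n)) w,
         positions_after w (first_positions m) =1 first_positions m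
       & remove_strands m w (first_positions m) = 1] ].

Definition is_a (m n i j : nat) : bool := (0 < i <= m) && (m < j <= m + n).
Definition is_s (m n k : nat) : bool := m < k < m + n.

Definition mixed_gen (m n : nat) : Type :=
  ({ij : nat * nat | is_a m n ij.1 ij.2} + {k : nat | is_s m n k})%type.
HB.instance Definition _ m n := Choice.on (mixed_gen m n).

Definition gen_a m n i j (h : is_a m n i j) : mixed_gen m n :=
  inl (exist (fun ij : nat * nat => is_a m n ij.1 ij.2) (i, j) h).
Definition gen_s m n k (h : is_s m n k) : mixed_gen m n :=
  inr (exist (fun k : nat => is_s m n k) k h).

Definition mixed_gen_val m n (x : mixed_gen m n) : braid (m + n) :=
  match x with
  | inl ij => pure_a (m + n) (val ij).1 (val ij).2
  | inr k => sigma (m + n) (val k)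
  end.

Inductive mixed_rel (m n : nat) :
    word (mixed_gen m n) -> word (mixed_gen m n) -> Prop :=
| mixed_rel_S1 k l (sk : is_s m n k) (sl : is_s m n l) :
    (k.+1 < l) || (l.+1 < k) ->
    mixed_rel [:: (gen_s sk, true); (gen_s sl, true)]
              [:: (gen_s sl, true); (gen_s sk, true)]
| mixed_rel_S2 k (sk : is_s m n k) (sk1 : is_s m n k.+1) :
    mixed_rel [:: (gen_s sk, true); (gen_s sk1, true); (gen_s sk, true)]
              [:: (gen_s sk1, true); (gen_s sk, true); (gen_s sk1, true)]
| mixed_rel_1 i j k (aij : is_a m n i j) (sk : is_s m n k) (e : bool) :
    (k.+2 <= j) || (j.+1 <= k) ->
    mixed_rel [:: (gen_s sk, false); (gen_a aij, e); (gen_s sk, true)]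
              [:: (gen_a aij, e)]
| mixed_rel_2 i j (aij : is_a m n i j) (aij1 : is_a m n i j.-1)
    (sj1 : is_s m n j.-1) (e : bool) :
    mixed_rel [:: (gen_a aij, e)]
              [:: (gen_s sj1, true); (gen_a aij1, e); (gen_s sj1, false)]
| mixed_rel_3 i j (aij : is_a m n i j) (aij1 : is_a m n i j.+1)
    (sj : is_s m n j) (e : bool) :
    mixed_rel [:: (gen_s sj, false); (gen_a aij, e); (gen_s sj, true)]
              [:: (gen_a aij, true); (gen_a aij1, e); (gen_a aij, false)]
| mixed_rel_4 i j r (aij : is_a m n i j) (arj1 : is_a m n r j.+1) (e : bool) :
    r < i ->
    mixed_rel [:: (gen_a aij, e); (gen_a arj1, e)]
              [:: (gen_a arj1, e); (gen_a aij, e)].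

(* Main.v *)
(* Read a braid as a crossing-by-crossing motion of m "fixed" strands (those
   that are kept) and n "moving" strands, and let G be the group presented by
   mixed_rel.

   Injectivity. The braid group acts on triples (K, y, q), where K is the set of
   positions of the fixed strands, y is an m-tuple in G satisfying the relations
   of the generators a_{r,m+1}, and q is in G. A crossing of two fixed strands
   applies a Hurwitz move to y, a crossing of two moving strands multiplies q by
   some sigma, and among the crossings of a fixed and a moving strand those of
   one of the two kinds multiply q by the loop of the moving strand around the
   fixed one, as expressed by y. In the Artin relations this uses exactly the
   given relations. The image of a word in the generators sends the base state
   with q = 1 to the base state with q the class of that word.

   Image. The braids [spread K] that carry the fixed strands from 1, ..., m to
   the positions in K form a Schreier transversal: along a word, the element
   that appears at each letter is a product of a braid of the fixed strands alone
   and of an element generated by the a_{ij} and sigma_l, and the subgroup generated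
   by these is normalised by the braids of the fixed strands. *)
From HB Require Import structures.
Require Import Defs.
From mathcomp Require Import all_boot.
From mathcomp Require Import boolp classical_sets.
From mathcomp Require Import zify.

Set Implicit Arguments.
Unset Strict Implicit.
Unset Printing Implicit Defensive.

Local Open Scope group_scope.

(** * Four-term relations and Hurwitz moves *)

Section GroupIdentities.
Variable G : groupType.
Implicit Types x y z g : G.

Lemma commuteMl x y z : commute x z -> commute y z -> commute (x * y) z.
Proof. by move=> xz yz; apply/commute_sym/commuteM; apply: commute_sym. Qed.

Lemma commuteVl x y : commute x y -> commute x^-1 y.
Proof. by move=> xy; apply/commute_sym/commuteV/commute_sym. Qed.

Lemma mulgAC_commute x y z : commute y z -> x * y * z = x * z * y.
Proof. by move=> yz; rewrite -!mulgA yz. Qed.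

Lemma mulgAC_conj x y z : x * z * y ^ z = x * y * z.
Proof. by rewrite -!mulgA -conjgC. Qed.

Lemma commuteJ g x y : commute (x ^ g) (y ^ g) <-> commute x y.
Proof.
rewrite /commute -!conjMg; split=> [|-> //]; exact: conjg_inj.
Qed.

Lemma conjg_commute x y : commute x y -> x ^ y = x.
Proof. by move=> xy; apply/conjg_fixP/commgP. Qed.

Lemma commute_conj x y z : commute x z -> commute y z -> commute (x ^ y) z.
Proof.
move=> xz yz; rewrite conjgE; apply: commuteMl; last exact: commuteMl.
exact: commuteVl.
Qed.

Definition braided x y := x * y * x = y * x * y.
Definition braided4 x y := x * y * x * y = y * x * y * x.

Lemma braided4J g x y : braided4 x y -> braided4 (x ^ g) (y ^ g).
Proof. by rewrite /braided4 -!conjMg => ->. Qed.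

Lemma braided_conj x y : braided x y -> x ^ (y * x) = y.
Proof.
move=> xy; apply: (mulgI (y * x)); rewrite -conjgC.
by rewrite mulgA xy.
Qed.

Lemma braided_conjV x y : braided x y -> x ^ y = y ^ x^-1.
Proof. by move=> xy; rewrite -{2}(braided_conj xy) conjgM conjgK. Qed.

(** With [x] = a_{ij} and [y] = sigma_j the right-hand side is relation (3), since (2) makes
    a_{i,j+1} the conjugate of a_{ij} by the inverse of sigma_j. Relation (3) is thus used
    everywhere in its symmetric four-term form. *)
Lemma braided4_conjV x y : braided4 x y <-> x ^ (y^-1 * x^-1) = x ^ y.
Proof.
have -> : x ^ (y^-1 * x^-1) = y^-1 * (y * x * y * x) * (x * y)^-1.
  by rewrite !conjgE !gnorm.
have -> : x ^ y = y^-1 * (x * y * x * y) * (x * y)^-1.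
  by rewrite !conjgE !gnorm.
by split=> [->|/mulIg/mulgI/esym].
Qed.

Lemma conjg_sq_braided4 x y :
  braided4 x y -> (x ^ y) ^ y = x ^ (x ^ y)^-1.
Proof.
move/braided4_conjV => xy.
by rewrite -[in LHS]xy -conjgM -conjVg [x^-1 ^ y]conjgE mulgA.
Qed.

Lemma braided4_mul u x y :
  braided4 x y -> u * y * x ^ y * x = u * x ^ y * x * y.
Proof.
move=> xy; rewrite -(mulgA u) -conjgC conjgE -!mulgA; congr (u * _).
by apply: (mulgI y); rewrite mulVKg !mulgA -xy.
Qed.

Lemma braided4_sq x y : braided x y -> braided4 (x * x) y.
Proof.
rewrite /braided /braided4 => xy.
transitivity (x * (x * y * x) * (x * y)); first by rewrite !mulgA.
rewrite xy; transitivity ((x * y * x) * (y * x * y)); first by rewrite !mulgA.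
rewrite -xy {1}xy; transitivity (y * x * (y * x * y) * x).
  by rewrite !mulgA.
by rewrite -xy !mulgA.
Qed.

Lemma braided4_commute x y : braided4 x y <-> commute x (y * x * y).
Proof. by rewrite /braided4 /commute !mulgA. Qed.

Section Hurwitz.
Variables a b z : G.
Hypotheses (az : braided4 a z) (bz : braided4 b z) (abz : commute a (b ^ z)).

Let baz : commute b (a ^ z^-1).
Proof. by apply/(commuteJ z); rewrite conjgKV; apply: commute_sym. Qed.

Let commute_hurwitz : commute (a ^ b) (b ^ z^-1).
Proof.
apply/(commuteJ b^-1); rewrite conjgK -conjgM.
by rewrite (proj1 (braided4_conjV _ _) bz).
Qed.

Lemma hurwitzV_commute : commute (b ^ a^-1) (a ^ z).
Proof.
apply/(commuteJ a); rewrite conjgKV.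
by rewrite -(proj1 (braided4_conjV _ _) az) conjgM conjgKV.
Qed.

Lemma hurwitz_commute : commute b ((a ^ b) ^ z).
Proof. by apply/(commuteJ z^-1); rewrite conjgK; apply: commute_sym. Qed.

(** The element factors both as [z * a * z] times [b ^ z] and as [a ^ z^-1] times [z * b * z]; [a]
    commutes with the first two factors and [b] with the last two. Every word in [a] and [b] then
    commutes with it, and each Hurwitz move is left with one further factor to treat. *)
Let commute_prod : commute a (z * (a * b) * z) /\ commute b (z * (a * b) * z).
Proof.
split.
  have ->: z * (a * b) * z = (z * a * z) * b ^ z by rewrite conjgE !gnorm.
  by apply: commuteM => //; apply/braided4_commute.
have ->: z * (a * b) * z = a ^ z^-1 * (z * b * z) by rewrite conjgE !gnorm.
by apply: commuteM => //; apply/braided4_commute.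
Qed.

Lemma hurwitz_braided4 : braided4 (a ^ b) z.
Proof.
apply/braided4_commute.
have ->: z * a ^ b * z = (b ^ z^-1)^-1 * (z * (a * b) * z).
  by rewrite !conjgE !gnorm.
apply: commuteM; first exact: commuteV.
by case: commute_prod => *; apply: commute_conj.
Qed.

Lemma hurwitzV_braided4 : braided4 (b ^ a^-1) z.
Proof.
apply/braided4_commute.
have ->: z * b ^ a^-1 * z = (z * (a * b) * z) * (a ^ z)^-1.
  by rewrite !conjgE !gnorm.
apply: commuteM; last by apply: commuteV; apply: hurwitzV_commute.
by case: commute_prod => *; apply: commute_conj => //; apply: commuteVl.
Qed.

End Hurwitz.
End GroupIdentities.

(** * Positions of the fixed strands and their ranks *)

Section Positions.
Implicit Type K : pred nat.

Lemma swap_positionsK i K : swap_positions i (swap_positions i K) = K.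
Proof.
by apply/funext => p; rewrite /swap_positions; congr K; do ?case: ifP; lia.
Qed.

Lemma swap_positions_l i K : swap_positions i K i = K i.+1.
Proof. by rewrite /swap_positions eqxx. Qed.

Lemma swap_positions_r i K : swap_positions i K i.+1 = K i.
Proof. by rewrite /swap_positions eqxx; case: eqP => //; lia. Qed.

Lemma swap_positions_out i K p :
  p != i -> p != i.+1 -> swap_positions i K p = K p.
Proof. by rewrite /swap_positions => /negPf-> /negPf->. Qed.

Lemma swap_positionsC i j K : i.+1 < j ->
  swap_positions i (swap_positions j K) = swap_positions j (swap_positions i K).
Proof.
move=> ij; apply/funext => p; rewrite /swap_positions; congr K.
by do ?case: ifP; lia.
Qed.

Lemma swap_positions_braid i K :
  swap_positions i (swap_positions i.+1 (swap_positions i K)) =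
  swap_positions i.+1 (swap_positions i (swap_positions i.+1 K)).
Proof.
apply/funext => p; rewrite /swap_positions; congr K.
by do ?case: ifP; lia.
Qed.

Lemma swap_positions_id i K : K i = K i.+1 -> swap_positions i K = K.
Proof.
move=> Ki; apply/funext => p; rewrite /swap_positions.
by case: eqVneq => [->//|_]; case: eqVneq => [->|].
Qed.

Lemma countS K i : count K (iota 1 i.+1) = count K (iota 1 i) + K i.+1.
Proof. by rewrite -{1}(addn1 i) iotaD count_cat /= addn0 add1n. Qed.

Lemma count_lt K i : 0 < i -> count K (iota 1 i) = count K (iota 1 i.-1) + K i.
Proof. by case: i => // i _; rewrite countS. Qed.

Lemma count_iota_le K i j : i <= j ->
  count K (iota 1 i) <= count K (iota 1 j) <= count K (iota 1 i) + (j - i).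
Proof.
move=> /subnKC <-; rewrite iotaD count_cat addKn leq_addr leq_add2l.
by rewrite -{2}(size_iota (1 + i) (j - i)) count_size.
Qed.

Lemma count_iota_size K i : count K (iota 1 i) <= i.
Proof. by rewrite -{2}(size_iota 1 i) count_size. Qed.

Lemma count_swap_lt i K j : j < i ->
  count (swap_positions i K) (iota 1 j) = count K (iota 1 j).
Proof.
move=> ji; apply: eq_in_count => p; rewrite mem_iota => pj.
by apply: swap_positions_out; lia.
Qed.

Lemma count_swap i K j : 0 < i < j ->
  count (swap_positions i K) (iota 1 j) = count K (iota 1 j).
Proof.
case/andP=> i0; elim: j => // j IHj; rewrite ltnS leq_eqVlt => /orP[/eqP<-|ij].
  case: i i0 {IHj} => // i _; rewrite !countS count_swap_lt //.
  by rewrite swap_positions_l swap_positions_r -!addnA (addnC (K _)).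
by rewrite !countS IHj // swap_positions_out //; lia.
Qed.

End Positions.

(** * Action of crossings on states *)

Section Threads.
Variables (Q : groupType) (m N : nat) (z : nat -> Q).
Hypothesis zC : forall k l, m < k -> k.+1 < l -> commute (z k) (z l).
Hypothesis zB : forall k, m < k -> k.+1 < N -> braided (z k) (z k.+1).

Definition thread p : Q := \prod_(m.+1 <= l < p) z l.

(* The loop of the moving strand [p] around the fixed strand [r], where [y r] is
   that of the first moving strand [m.+1]. *)
Definition loop (y : nat -> Q) r p : Q := y r ^ thread p.

(** The classical Hurwitz move, which preserves the product of the entries [r] and [r.+1]. The
    conjugated entry is forced by the braid relation for a moving strand followed by two fixed
    ones. *)
Definition hurwitz r (y : nat -> Q) : nat -> Q := fun j =>
  if j == r then y r.+1 else if j == r.+1 then y r ^ y r.+1 else y j.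
Definition hurwitzV r (y : nat -> Q) : nat -> Q := fun j =>
  if j == r then y r.+1 ^ (y r)^-1 else if j == r.+1 then y r else y j.

(** These are relations (1), (3) and (4) for the first moving strand alone; the relations for the
    other moving strands follow by conjugation. *)
Record compatible (y : nat -> Q) : Prop := Compatible {
  compat_far r l : m.+1 < l -> commute (y r) (z l);
  compat_braid4 r : m.+1 < N -> braided4 (y r) (z m.+1);
  compat_ranks r r' : m.+1 < N -> r < r' -> commute (y r) (y r' ^ z m.+1) }.

Lemma hurwitzK r : cancel (hurwitz r) (hurwitzV r).
Proof.
move=> y; apply/funext => j; rewrite /hurwitz /hurwitzV !eqxx.
have -> : (r.+1 == r) = false by lia.
have [->|_] := eqVneq j r; first by rewrite conjgK.
by have [->|] := eqVneq j r.+1.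
Qed.

Lemma hurwitzVK r : cancel (hurwitzV r) (hurwitz r).
Proof.
move=> y; apply/funext => j; rewrite /hurwitz /hurwitzV !eqxx.
have -> : (r.+1 == r) = false by lia.
have [->//|_] := eqVneq j r.
by have [->|] := eqVneq j r.+1; rewrite ?conjgKV.
Qed.

Lemma hurwitz_compatible r y : compatible y -> compatible (hurwitz r y).
Proof.
case=> far br4 rk; split=> [j l lm|j mN|j j' mN jj']; rewrite /hurwitz.
- by do 2?case: eqP => _; try apply: commute_conj; apply: far.
- case: eqP => [_|_]; first exact: br4.
  by case: eqP => [_|_]; [apply: hurwitz_braided4; auto | apply: br4].
have [jr|jr] := eqVneq j r.
  have [|j'r] := eqVneq j' r; first by lia.
  have [_|j'r1] := eqVneq j' r.+1; first by apply: hurwitz_commute; auto.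
  by apply: rk => //; lia.
have [jr1|jr1] := eqVneq j r.+1.
  have [|_] := eqVneq j' r; first by lia.
  have [|_] := eqVneq j' r.+1; first by lia.
  by apply: commute_conj; apply: rk => //; lia.
have [j'r|j'r] := eqVneq j' r; first by apply: rk => //; lia.
have [j'r1|j'r1] := eqVneq j' r.+1; last exact: rk.
by rewrite conjJg; apply/commute_sym/commute_conj; apply/commute_sym/rk; lia.
Qed.

Lemma hurwitzV_compatible r y : compatible y -> compatible (hurwitzV r y).
Proof.
case=> far br4 rk; split=> [j l lm|j mN|j j' mN jj']; rewrite /hurwitzV.
- do 2?case: eqP => _; try apply: commute_conj; try apply: commuteVl;
  exact: far.
- case: eqP => [_|_]; first by apply: hurwitzV_braided4; auto.
  by case: eqP => [_|_]; apply: br4.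
have [jr|jr] := eqVneq j r.
  have [|j'r] := eqVneq j' r; first by lia.
  have [_|j'r1] := eqVneq j' r.+1; first by apply: hurwitzV_commute; auto.
  by apply: commute_conj; [|apply: commuteVl]; apply: rk => //; lia.
have [jr1|jr1] := eqVneq j r.+1.
  have [|_] := eqVneq j' r; first by lia.
  have [|_] := eqVneq j' r.+1; first by lia.
  by apply: rk => //; lia.
have [j'r|j'r] := eqVneq j' r; last first.
  by have [j'r1|j'r1] := eqVneq j' r.+1; apply: rk => //; lia.
rewrite conjJg conjVg; apply/commute_sym/commute_conj; last apply: commuteVl.
  by apply/commute_sym/rk => //; lia.
by apply/commute_sym/rk => //; lia.
Qed.

Lemma loopS y r p : m < p -> loop y r p.+1 = loop y r p ^ z p.
Proof. by move=> mp; rewrite /loop /thread big_nat_recr //= conjgM. Qed.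

Lemma loop0 y r : loop y r m.+1 = y r.
Proof. by rewrite /loop /thread big_geq ?conjg1. Qed.

Lemma loop_hurwitz y r r' p : r' != r -> r' != r.+1 ->
  loop (hurwitz r y) r' p = loop y r' p.
Proof. by move=> /negPf r'r /negPf r'r1; rewrite /loop /hurwitz r'r r'r1. Qed.

Lemma loop_hurwitz_l y r p : loop (hurwitz r y) r p = loop y r.+1 p.
Proof. by rewrite /loop /hurwitz eqxx. Qed.

Lemma loop_hurwitz_r y r p :
  loop (hurwitz r y) r.+1 p = loop y r p ^ loop y r.+1 p.
Proof. by rewrite /loop /hurwitz eqxx -conjJg; case: eqP => //; lia. Qed.

Lemma hurwitz_comm y r r' : r.+1 < r' ->
  hurwitz r (hurwitz r' y) = hurwitz r' (hurwitz r y).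
Proof.
move=> rr'; apply/funext => j; rewrite /hurwitz.
by have [?|?] := eqVneq j r; have [?|?] := eqVneq j r.+1;
  have [?|?] := eqVneq j r'; have [?|?] := eqVneq j r'.+1;
  do ?case: ifP; (lia || done).
Qed.

Lemma hurwitz_braid y r :
  hurwitz r (hurwitz r.+1 (hurwitz r y)) =
  hurwitz r.+1 (hurwitz r (hurwitz r.+1 y)).
Proof.
apply/funext => j; rewrite /hurwitz !eqxx.
have [-> ->] : (r.+1 == r) = false /\ (r == r.+1) = false by lia.
have [-> ->] : (r.+2 == r) = false /\ (r.+2 == r.+1) = false by lia.
have -> : (r == r.+2) = false by lia.
have [->|_] := eqVneq j r; first by do ?case: ifP; (lia || done).
have [//|_] := eqVneq j r.+1.
by have [_|_] := eqVneq j r.+2; rewrite // -conjJg.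
Qed.

(** * Relations among the loops of all moving strands *)

Section Loops.
Variable y : nat -> Q.
Hypothesis yc : compatible y.

Lemma loop_gt r p l : m < p -> p < l -> commute (loop y r p) (z l).
Proof.
elim: p => // p IHp; rewrite ltnS leq_eqVlt => /orP[/eqP<-|mp] pl.
  by rewrite loop0; apply: compat_far yc _ _ _.
by rewrite loopS //; apply: commute_conj; [apply: IHp; lia | apply: zC; lia].
Qed.

(** In the first case, [p = l.+2], the conjugation by [z l * z l.+1] that takes the loop at [l] to
    the one at [p] also takes [z l.+1] to [z l], so [loop_gt] applies. Further conjugations are by
    generators far from [z l]. *)
Lemma loop_lt r p l : m < l -> l.+1 < p -> p <= N -> commute (loop y r p) (z l).
Proof.
move=> ml; elim: p => // p IHp; rewrite ltnS leq_eqVlt => /orP[/eqP<-|lp] pN.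
  rewrite !loopS; [|lia..]; rewrite -conjgM.
  rewrite -[X in commute _ X](braided_conj (esym (zB ml _))); last by lia.
  by apply/commuteJ; apply: loop_gt => //; lia.
rewrite loopS; last by lia.
by apply: commute_conj; [apply: IHp; lia | apply/commute_sym/zC].
Qed.

(** Conjugation by [z p.+1 * z p] raises the index of the loops at [p] and [p.+1] and of [z p] by
    one. Relations among these hence propagate from the first moving strand to all others. *)
Lemma loop_shift r p :
  m < p -> p.+1 < N -> loop y r p.+1 = loop y r p ^ (z p.+1 * z p).
Proof.
move=> mp pN.
by rewrite loopS // conjgM (conjg_commute (@loop_gt r p p.+1 _ _)).
Qed.

Lemma loop_shift1 r p : m < p -> p.+1 < N ->
  loop y r p.+2 = loop y r p.+1 ^ (z p.+1 * z p).
Proof.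
move=> mp pN; rewrite conjgM -loopS; last lia.
by rewrite (conjg_commute (@loop_lt r p.+2 p _ _ _)).
Qed.

Lemma loop_braid4 r p : m < p -> p < N -> braided4 (loop y r p) (z p).
Proof.
elim: p => // p IHp; rewrite ltnS leq_eqVlt => /orP[/eqP<-|mp] pN.
  by rewrite loop0; apply: compat_braid4 yc _ _.
rewrite loop_shift // -[z p.+1 in X in braided4 _ X](braided_conj (zB mp pN)).
by apply: braided4J; apply: IHp; lia.
Qed.

Lemma loop_commute r r' p p' : m < p -> p < p' -> p' <= N -> r < r' ->
  commute (loop y r p) (loop y r' p').
Proof.
move=> mp pp' p'N rr'.
(* Neighbouring moving strands come first, by shifting [compat_ranks]; then [p'] grows by
   conjugation with generators that fix the loop at [p]. *)
have adj : forall p, m < p -> p < N -> commute (loop y r p) (loop y r' p.+1).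
  elim=> // {mp pp' p'N}p IHp.
  rewrite ltnS leq_eqVlt => /orP[/eqP<-|mp] pN.
    by rewrite (@loopS _ r') // !loop0; apply: compat_ranks.
  rewrite loop_shift // loop_shift1 //; apply/commuteJ.
  by apply: IHp => //; lia.
elim: p' pp' p'N => // p' IHp'.
rewrite ltnS leq_eqVlt => /orP[/eqP<-|pp'] p'N; first exact: adj.
rewrite loopS; last by lia.
apply/commute_sym/commute_conj; apply: commute_sym; last exact: loop_gt.
by apply: IHp' => //; lia.
Qed.

End Loops.

(** * Crossings as operators on states *)

Definition state := (pred nat * (nat -> Q) * Q)%type.

(* [r] is the rank of the first fixed strand and [p] that of the first moving
   strand (numbered from [m + 1]) in the crossing, if there are such strands. *)
Definition step i (e : bool) (st : state) : state :=
  let: (K, y, q) := st in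
  let r := (count K (iota 1 i.-1)).+1 in let p := m + i - r.-1 in
  (swap_positions i K,
   if K i && K i.+1 then (if e then hurwitz else hurwitzV) r y else y,
   q * match K i, K i.+1 with
       | true, true => 1
       | true, false => if e then 1 else (loop y r p)^-1
       | false, true => if e then loop y r p else 1
       | false, false => if e then z p else (z p)^-1
       end).

(** With exactly [m] fixed strands among the [N] positions, the ranks of the moving strands stay
    between m + 1 and [N], where the relations on [z] and the loops are available. *)
Definition admissible (st : state) : Prop :=
  compatible st.1.2 /\ count st.1.1 (iota 1 N) = m.

Lemma step_admissible i e st :
  0 < i < N -> admissible st -> admissible (step i e st).
Proof.
case: st => [[K y] q] iN [/= yc KN]; split=> /=; last by rewrite count_swap.
case: ifP => // _.
by case: e; [apply: hurwitz_compatible|apply: hurwitzV_compatible].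
Qed.

(** The inverse crossing is read from the swapped positions: a loop gained by a positive
    moving-fixed crossing is cancelled by the negative fixed-moving one. The table in [step] is
    arranged for this. *)
Lemma stepK i e st : 0 < i -> step i (~~ e) (step i e st) = st.
Proof.
case: st => [[K y] q] i0.
rewrite /step count_swap_lt ?prednK // swap_positionsK.
rewrite swap_positions_l swap_positions_r.
case: (K i); case: (K i.+1); case: e;
  by rewrite /= ?hurwitzK ?hurwitzVK ?gnorm.
Qed.

Lemma step_comm i j st : 0 < i -> i.+1 < j -> j < N -> admissible st ->
  step j true (step i true st) = step i true (step j true st).
Proof.
case: st => [[K y] q] i0 ij jN [/= yc KN].
rewrite /step /=.
have -> : count (swap_positions j K) (iota 1 i.-1) = count K (iota 1 i.-1).
  by apply: count_swap_lt; lia.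
have -> : count (swap_positions i K) (iota 1 j.-1) = count K (iota 1 j.-1).
  by apply: count_swap; lia.
rewrite !(@swap_positions_out i) ?(@swap_positions_out j); try lia.
rewrite (@swap_positionsC i j) //.
have := @count_iota_le K i.+1 j.-1 ltac:(lia).
have := @count_iota_le K j.+1 N ltac:(lia).
have := count_iota_size K i.-1.
rewrite !countS (count_lt K i0) (@count_lt K j) ?KN; last by lia.
set c := count K (iota 1 i.-1); set d := count K (iota 1 j.-1).
(* Goals remain when both crossings act on the tuple, when one acts on the tuple and the other reads
   a loop, or when each multiplies [q]. Two loops commute by the extension of relation (4), since
   both the rank of the fixed strand and that of the moving strand increase from [i] to [j]. *)
case: (K i); case: (K i.+1); case: (K j); case: (K j.+1);
  rewrite /= ?mulg1 => c_le dN cd; congr (_, _, _).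
- by symmetry; apply: hurwitz_comm; lia.
- by rewrite loop_hurwitz //; lia.
- by rewrite loop_hurwitz //; lia.
- by apply: mulgAC_commute; apply: loop_commute => //; lia.
- by apply: mulgAC_commute; apply: loop_gt => //; lia.
- by apply/mulgAC_commute/commute_sym/loop_lt => //; lia.
- by apply/mulgAC_commute/zC; lia.
Qed.

Lemma step_braid i st : 0 < i -> i.+1 < N -> admissible st ->
  step i true (step i.+1 true (step i true st)) =
  step i.+1 true (step i true (step i.+1 true st)).
Proof.
case: st => [[K y] q] i0 iN [/= yc KN].
rewrite /step /=.
rewrite swap_positions_braid.
rewrite !(count_lt _ i0) !count_swap_lt ?prednK //; try lia.
rewrite !(swap_positions_l, swap_positions_r) !(@swap_positions_out i _ i.+2);
  try lia.
rewrite !(@swap_positions_out i.+1 _ i); try lia.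
rewrite !(swap_positions_l, swap_positions_r).
have := @count_iota_le K i.+2 N ltac:(lia).
have := count_iota_size K i.-1.
rewrite !countS (count_lt K i0) KN.
set c := count K (iota 1 i.-1).
have pE : m + i.+1 - c = (m + i - c).+1.
  have : c <= i by have := count_iota_size K i.-1; lia.
  lia.
have pE1 : m + i.+1 - c.+1 = m + i - c by lia.
(* With F for fixed and M for moving, the goals that remain are FFF, FMF, FMM, MFF, MFM, MMF and
   MMM, in this order. MFF determines the Hurwitz move, MFM is the recursion for loops, and MMF is
   the four-term relation. *)
case: (K i); case: (K i.+1); case: (K i.+2);
  rewrite /= ?mulg1 ?addn0 ?addn1 /= => c_le cN; congr (_, _, _).
- exact: hurwitz_braid.
- by rewrite loop_hurwitz_l pE1.
- by rewrite pE1.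
- by rewrite pE1 loop_hurwitz_l loop_hurwitz_r mulgAC_conj.
- by rewrite pE1 pE loopS ?(mulgAC_conj q) //; lia.
- rewrite pE1 pE; set p := m + i - c.
  have xz : braided4 (loop y c.+1 p) (z p) by apply: loop_braid4 => //; lia.
  rewrite loopS; last lia.
  move: xz.
  by move: (loop y c.+1 p) (z p) => x w; apply: braided4_mul.
- rewrite pE; set p := m + i - c.
  by rewrite -!(mulgA q) zB //; lia.
Qed.

Definition run (w : word (braid_gen N)) (st : state) : state :=
  foldl (fun st l => step (val l.1) l.2 st) st w.

Lemma run_admissible w st : admissible st -> admissible (run w st).
Proof.
elim: w st => //= l w IHw st adm.
by apply/IHw/step_admissible => //; exact: valP l.1.
Qed.

Lemma run_eqv u v st :
  word_eqv (@braid_rel N) u v -> admissible st -> run u st = run v st.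
Proof.
move=> uv; elim: uv st => {u v} [u v uv|s e|//|u v _ IH|u v w _ IHu _ IHv|
  u u' v v' _ IHu _ IHv] st adm.
- case: uv => [s t st_far|s t ts];
    case/andP: (valP s) (valP t) => s0 sN /andP[t0 tN].
    rewrite /run /=; case/orP: st_far => st_far; last symmetry;
    by apply: step_comm.
  rewrite /run /= ts; apply: step_braid => //; by rewrite -ts.
- by rewrite /run /= stepK //; case/andP: (valP s).
- by rewrite IH.
- by rewrite IHu // IHv.
- by rewrite /run !foldl_cat -!/(run _ _) IHu // IHv //; apply: run_admissible.
Qed.

End Threads.

(** * Presented groups and braid relations *)

Definition literal (G : groupType) (e : bool) (x : G) : G :=
  if e then x else x^-1.

Definition eval_word (X : Type) (G : groupType) (f : X -> G) (w : word X) : G :=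
  \prod_(l <- w) literal l.2 (f l.1).

Lemma literalJ (G : groupType) e (x g : G) :
  literal e (x ^ g) = literal e x ^ g.
Proof. by case: e; rewrite //= conjVg. Qed.

Lemma literalN (G : groupType) e (x : G) : literal (~~ e) x = (literal e x)^-1.
Proof. by case: e; rewrite //= invgK. Qed.

Section PresentedGroups.
Variables (X : choiceType) (R : word X -> word X -> Prop).
Implicit Types u v w : word X.

Lemma word_class_cat u v :
  word_class R (u ++ v) = word_class R u * word_class R v.
Proof.
apply/word_classP; apply: word_eqv_cat; exact/word_eqv_sym/word_eqv_repr.
Qed.

Lemma word_class_nil : word_class R [::] = 1.
Proof. by []. Qed.

Lemma word_class_inv w : word_class R (word_inv w) = (word_class R w)^-1.
Proof.
apply: (mulgI (word_class R w)); rewrite mulgV -word_class_cat.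
exact/word_classP/word_eqv_catV.
Qed.

Lemma word_class_letter x e :
  word_class R [:: (x, e)] = literal e (presented_gen R x).
Proof. by case: e => //=; rewrite -word_class_inv. Qed.

Lemma word_class_cons x e w :
  word_class R ((x, e) :: w) = literal e (presented_gen R x) * word_class R w.
Proof. by rewrite -cat1s word_class_cat word_class_letter. Qed.

Lemma word_classE w : word_class R w = eval_word (presented_gen R) w.
Proof.
elim: w => [|[x e] w IHw]; first by rewrite /eval_word big_nil.
by rewrite word_class_cons IHw /eval_word big_cons.
Qed.

Variables (G : groupType) (f : X -> G).

Lemma eval_word_eqv u v :
  (forall u v, R u v -> eval_word f u = eval_word f v) ->
  word_eqv R u v -> eval_word f u = eval_word f v.
Proof.
move=> fR; elim=> {u v} [u v /fR//|x e|//|u v _ -> //|u v w _ -> _ -> //|].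
  by rewrite /eval_word !big_cons !big_nil literalN mulg1 mulgV.
by move=> u u' v v' _ uu' _ vv'; rewrite /eval_word !big_cat; congr (_ * _).
Qed.

Lemma presented_lift :
  (forall u v, R u v -> eval_word f u = eval_word f v) ->
  exists phi : UMagmaMorphism.type (presented R) G,
    forall w, phi (word_class R w) = eval_word f w.
Proof.
move=> fR; pose phi (x : presented R) := eval_word f (repr x).
have phiE w : phi (word_class R w) = eval_word f w.
  by apply: eval_word_eqv => //; apply: word_eqv_repr.
have phiM : monoid_morphism phi.
  split=> [|x y]; first by rewrite (phiE [::]) /eval_word big_nil.
  rewrite -[x]word_class_repr -[y]word_class_repr -word_class_cat.
  by rewrite !phiE /eval_word big_cat.
pose phi_mul := isUMagmaMorphism.Build _ _ phi phiM.
pose phi' : UMagmaMorphism.type (presented R) G := HB.pack phi phi_mul.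
by exists phi'.
Qed.

End PresentedGroups.

(** Meant for a_{ij} with [j] fixed: [pure_a_left] expresses it through a_{i+1,j}, so inductions
    start at i = j - 1 and descend. *)
Lemma descending_ind j (P : nat -> Prop) :
  (forall i, i.+1 = j -> P i) -> (forall i, i.+1 < j -> P i.+1 -> P i) ->
  forall i, i < j -> P i.
Proof.
move=> P1 PS i ij; have [d jE] : exists d, j = i + d.+1.
  by exists (j - i.+1); lia.
elim: d i {ij} jE => [|d IHd] i jE; first by apply: P1; lia.
by apply: PS; [lia | apply: IHd; lia].
Qed.

(** * Conjugation and commutation of the a_{ij} in the Artin group *)

Section BraidGroup.
Variable k : nat.
Local Notation s := (sigma k).
Local Notation a := (pure_a k).

Lemma sigmaE (x : braid_gen k) : s (val x) = presented_gen (@braid_rel k) x.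
Proof. by rewrite /sigma valK. Qed.

Lemma sigma_far i j : i.+1 < j -> commute (s i) (s j).
Proof.
move=> ij; rewrite /sigma.
case: insubP => [x _ xi|_]; last exact/commute_sym/commute1.
case: insubP => [y _ yj|_]; last exact/commute1.
rewrite /commute -!word_class_cat; apply/word_classP/word_eqv_rel.
by apply: braid_rel_comm; rewrite xi yj ij.
Qed.

Lemma sigma_braid i : 0 < i -> i.+1 < k -> braided (s i) (s i.+1).
Proof.
move=> i0 ik; rewrite /sigma.
case: insubP => [x _ xi|]; last by lia.
case: insubP => [y _ yj|]; last by lia.
have : word_class (@braid_rel k) [:: (x, true); (y, true); (x, true)] =
       word_class (@braid_rel k) [:: (y, true); (x, true); (y, true)].
  by apply/word_classP/word_eqv_rel/braid_rel_braid; rewrite xi yj.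
by rewrite !word_class_cons word_class_nil !mulg1 /braided !mulgA.
Qed.

Lemma pure_a_adj i : a i i.+1 = s i * s i.
Proof.
by rewrite /pure_a /= /index_iota subnn !big_nil mul1g mulg1 expg2.
Qed.

Lemma pure_a_left i j : i.+1 < j -> a i j = a i.+1 j ^ s i.
Proof.
move=> ij; rewrite /pure_a big_ltn; last by lia.
have -> : index_iota i j.-1 = i :: index_iota i.+1 j.-1.
  by rewrite /index_iota -(@subnSK i) //; lia.
by rewrite rev_cons -cats1 big_cat big_seq1 conjgE /= !mulgA.
Qed.

Lemma commute_pure_a i j x : i < j ->
  (forall l, i <= l < j -> commute (s l) x) -> commute (a i j) x.
Proof.
move: i; apply: descending_ind => [i <- sx|i ij IH sx].
  by rewrite pure_a_adj; apply: commuteMl; apply: sx; lia.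
rewrite pure_a_left //; apply: commute_conj; last by apply: sx; lia.
by apply: IH => l lij; apply: sx; lia.
Qed.

Lemma pure_a_far i j l : i < j -> j < l -> commute (a i j) (s l).
Proof.
by move=> ij jl; apply: commute_pure_a => // p pij; apply: sigma_far; lia.
Qed.

Lemma pure_a_far_left i j l : l.+1 < i -> i < j -> commute (a i j) (s l).
Proof.
move=> li ij; apply: commute_pure_a => // p pij.
by apply/commute_sym/sigma_far; lia.
Qed.

(** This links the two expressions of a_{ij}. For adjacent indices it is the braid relation applied
    to a square; otherwise the outer conjugations by sigma_i and sigma_j commute. *)
Lemma pure_a_right i j : 0 < i -> i < j -> j < k -> a i j.+1 = a i j ^ (s j)^-1.
Proof.
move=> i0 ij jk; move: i ij i0; apply: descending_ind => [i ij i0|i ij IH i0].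
  rewrite -{}ij in jk *; rewrite pure_a_left // !pure_a_adj.
  by rewrite !conjMg (braided_conjV (esym (sigma_braid i0 _))).
rewrite pure_a_left; last lia.
rewrite (pure_a_left ij) IH // -!conjgM; congr (_ ^ _).
exact/commuteVl/commute_sym/sigma_far.
Qed.

(** The shortest case, l = i + 1 and j = i + 3, reduces by conjugation and one braid relation to
    sigma_i^2 commuting with sigma_{i+2}. Extending the interval on either side conjugates by a
    generator far from sigma_l. *)
Lemma pure_a_inner i j l : 0 < i -> i < l -> l.+1 < j -> j <= k ->
  commute (a i j) (s l).
Proof.
move=> i0 il lj jk; move: i il i0.
apply: descending_ind => [i il i0|i il IH i0].
  rewrite -{}il in lj *; move: j lj jk; elim=> // j IHj.
  rewrite ltnS leq_eqVlt => /orP[/eqP <-|ij] jk.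
    rewrite pure_a_right //; try lia.
    apply/(commuteJ (s i.+2)); rewrite conjgKV.
    rewrite (braided_conjV (sigma_braid _ _)) //.
    rewrite pure_a_right //; try lia.
    by apply/commuteJ; apply: pure_a_far; lia.
  rewrite pure_a_right; [|lia..].
  apply: commute_conj; first by apply: IHj; lia.
  by apply/commuteVl/commute_sym/sigma_far; lia.
rewrite pure_a_left; last lia.
by apply: commute_conj; [apply: IH|apply: sigma_far].
Qed.

Lemma pure_a_braid4 i j : 0 < i -> i < j -> j < k -> braided4 (a i j) (s j).
Proof.
move=> i0 ij jk; move: i ij i0; apply: descending_ind => [i ij i0|i ij IH i0].
  by rewrite -{}ij in jk *; rewrite pure_a_adj; apply/braided4_sq/sigma_braid.
rewrite pure_a_left // -[s j](@conjg_commute _ _ (s i)).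
  by apply/braided4J/IH.
exact/commute_sym/sigma_far.
Qed.

Lemma pure_a_nested r i j : 0 < r -> r < i -> i < j -> j < k ->
  commute (a i j) (a r j.+1).
Proof.
move=> r0 ri ij jk; apply: commute_pure_a => // l lij.
by apply/commute_sym/pure_a_inner => //; lia.
Qed.

End BraidGroup.

(** * The mixed braid relations *)

Section MixedGroup.
Variables m n : nat.
Local Notation R := (@mixed_rel m n).
Local Notation Q := (presented R).
Local Notation s := (sigma (m + n)).
Local Notation a := (pure_a (m + n)).

Lemma is_aP i j : is_a m n i j -> [/\ 0 < i, i <= m, m < j & j <= m + n].
Proof. by case/andP=> /andP[? ?] /andP[? ?]. Qed.

Lemma mixed_gen_val_rel u v :
  R u v -> eval_word (@mixed_gen_val m n) u = eval_word (@mixed_gen_val m n) v.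
Proof.
case=> {u v} [k l sk sl kl|k sk sk1|i j k aij sk e jk|i j aij aij1 sj1 e
  |i j aij aij1 sj e|i j r aij arj1 e ri];
  rewrite /eval_word !big_cons !big_nil /literal /= !mulg1.
- by case/orP: kl => kl; [|symmetry]; apply: sigma_far.
- rewrite !mulgA; apply: sigma_braid; case/andP: sk sk1 => ? ? /andP[? ?]; lia.
- have [i0 im mj jN] := is_aP aij; have /andP[mk kN] := sk.
  rewrite -/(literal e _) -conjgE -literalJ conjg_commute //.
  by case/orP: jk => jk; [apply: pure_a_inner|apply: pure_a_far]; lia.
- have [i0 im mj jN] := is_aP aij; have [_ _ mj1 _] := is_aP aij1.
  rewrite -/(literal e (a i j)) -/(literal e (a i j.-1)).
  rewrite -[j in LHS]prednK ?pure_a_right ?literalJ; try lia.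
  by rewrite conjgE invgK.
- have [i0 im mj jN] := is_aP aij; have [_ _ _ j1N] := is_aP aij1.
  rewrite -/(literal e (a i j)) -/(literal e (a i j.+1)).
  rewrite -conjgE -literalJ.
  (* Relation (3): the conjugate by sigma_j is rewritten through the four-term relation, so that
     a_{i,j+1} appears as the inner conjugate. *)
  rewrite -(proj1 (braided4_conjV _ _) (pure_a_braid4 _ _ _)) //; try lia.
  by rewrite conjgM -pure_a_right; [rewrite literalJ conjgE invgK|lia..].
have [i0 im mj jN] := is_aP aij; have [r0 rm _ j1N] := is_aP arj1.
have ac : commute (a i j) (a r j.+1) by apply: pure_a_nested; lia.
by case: e => //; apply: commuteV; apply: commuteVl.
Qed.

(** The generators are extended by 1 to all indices, so that the action can be set up with relations
    indexed by arbitrary integers. *)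
Definition mixed_a i j : Q :=
  if insub (i, j) is Some x then presented_gen R (inl x) else 1.
Definition mixed_s l : Q :=
  if insub l is Some x then presented_gen R (inr x) else 1.

Lemma mixed_aE i j (h : is_a m n i j) :
  mixed_a i j = presented_gen R (gen_a h).
Proof. by rewrite /mixed_a insubT. Qed.

Lemma mixed_sE l (h : is_s m n l) : mixed_s l = presented_gen R (gen_s h).
Proof. by rewrite /mixed_s insubT. Qed.

Lemma mixed_relE u v : R u v ->
  eval_word (presented_gen R) u = eval_word (presented_gen R) v.
Proof. by rewrite -!word_classE => uv; apply/word_classP/word_eqv_rel. Qed.

Lemma mixed_s_far k l : k.+1 < l -> commute (mixed_s k) (mixed_s l).
Proof.
move=> kl; have [sk|/negPf sk] := boolP (is_s m n k); last first.
  by rewrite /mixed_s insubF //; apply/commute_sym/commute1.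
have [sl|/negPf sl] := boolP (is_s m n l); last first.
  by rewrite /commute {2 3}/mixed_s insubF // mul1g mulg1.
have /mixed_relE := mixed_rel_S1 sk sl (introT orP (or_introl kl)).
by rewrite /eval_word !big_cons !big_nil /= !mulg1 -!mixed_sE.
Qed.

Lemma mixed_s_braid l : m < l -> l.+1 < m + n ->
  braided (mixed_s l) (mixed_s l.+1).
Proof.
move=> ml lN; have sl : is_s m n l by apply/andP; lia.
have sl1 : is_s m n l.+1 by apply/andP; lia.
have /mixed_relE := mixed_rel_S2 sl sl1.
by rewrite /eval_word !big_cons !big_nil /= !mulg1 -!mixed_sE !mulgA.
Qed.

Lemma mixed_a_far i j l :
  (l.+2 <= j) || (j.+1 <= l) -> commute (mixed_a i j) (mixed_s l).
Proof.
move=> jl; have [sl|/negPf sl] := boolP (is_s m n l); last first.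
  by rewrite {1}/mixed_s insubF //; apply/commute1.
have [aij|/negPf aij] := boolP (is_a m n i j); last first.
  by rewrite /mixed_a insubF //; apply/commute_sym/commute1.
have /mixed_relE := mixed_rel_1 aij sl true jl.
rewrite /eval_word !big_cons !big_nil /= !mulg1 -!mixed_sE -!mixed_aE -conjgE.
by move/conjg_fixP/commgP.
Qed.

Lemma mixed_a_right i j : 0 < i <= m -> m < j < m + n ->
  mixed_a i j.+1 = mixed_a i j ^ (mixed_s j)^-1.
Proof.
move=> im mj; have sj : is_s m n j by [].
have aij : is_a m n i j by apply/andP; lia.
have aij1 : is_a m n i j.+1 by apply/andP; lia.
have /mixed_relE := @mixed_rel_2 m n i j.+1 aij1 aij sj true.
rewrite /eval_word !big_cons !big_nil /= !mulg1 -!mixed_sE -!mixed_aE => ->.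
by rewrite conjgE invgK.
Qed.

Lemma mixed_a_braid4 i j : 0 < i <= m -> m < j < m + n ->
  braided4 (mixed_a i j) (mixed_s j).
Proof.
move=> im mj; have sj : is_s m n j by [].
have aij : is_a m n i j by apply/andP; lia.
have aij1 : is_a m n i j.+1 by apply/andP; lia.
have /mixed_relE := mixed_rel_3 aij aij1 sj true.
rewrite /eval_word !big_cons !big_nil /= !mulg1 -!mixed_sE -!mixed_aE.
rewrite -conjgE => sa; apply/braided4_conjV.
by rewrite conjgM -mixed_a_right // sa conjgE invgK.
Qed.

Lemma mixed_a_nested r i j : r < i -> 0 < r -> i <= m -> m < j < m + n ->
  commute (mixed_a i j) (mixed_a r j.+1).
Proof.
move=> ri r0 im mj.
have aij : is_a m n i j by apply/andP; lia.
have arj1 : is_a m n r j.+1 by apply/andP; lia.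
have /mixed_relE := mixed_rel_4 aij arj1 true ri.
by rewrite /eval_word !big_cons !big_nil /= !mulg1 -!mixed_aE.
Qed.

(* Trivial for [r] outside of 1, ..., m. *)
Definition core_loop r : Q := mixed_a r m.+1.

Lemma core_loop_compatible : compatible m (m + n) mixed_s core_loop.
Proof.
have out r : ~~ (0 < r <= m) -> core_loop r = 1.
  by move=> rm; rewrite /core_loop /mixed_a insubF // /is_a (negPf rm).
split=> [r l ml|r mN|r r' mN rr'].
- by apply: mixed_a_far; lia.
- have [rm|/out->] := boolP (0 < r <= m); last by rewrite /braided4 !gnorm.
  by apply: mixed_a_braid4; lia.
have [rm|/out->] := boolP (0 < r <= m); last exact/commute_sym/commute1.
have [rm'|/out->] := boolP (0 < r' <= m); last first.
  by rewrite conj1g; apply/commute1.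
(* Conjugation moves sigma_{m+1} from the higher rank to the lower one as its inverse, giving
   a_{r,m+2} and a_{r',m+1} as in relation (4). *)
apply/(commuteJ (mixed_s m.+1)^-1); rewrite conjgK -mixed_a_right //; last lia.
by apply/commute_sym/mixed_a_nested; lia.
Qed.

End MixedGroup.

Lemma count_pred_interval (P : pred nat) i j :
  (forall p, 0 < p <= j -> P p = (p <= i)) -> i <= j -> count P (iota 1 j) = i.
Proof.
move=> Pi; elim: j Pi => [|j IHj] Pi; first by rewrite leqn0 => /eqP.
rewrite leq_eqVlt countS Pi; last by rewrite leqnn.
case/orP=> [/eqP ij|ij].
  rewrite ij in Pi *; rewrite leqnn addn1; congr _.+1.
  rewrite -[RHS](size_iota 1); apply/eqP; rewrite -all_count.
  by apply/allP => p; rewrite mem_iota => pj; rewrite Pi; lia.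
have -> : (j < i) = false by lia.
rewrite addn0; apply: IHj; last by lia.
by move=> p pj; apply: Pi; lia.
Qed.

(** * The action on the base state and injectivity *)

Section Action.
Variables m n : nat.
Local Notation R := (@mixed_rel m n).
Local Notation Q := (presented R).
Local Notation s := (sigma (m + n)).
Local Notation a := (pure_a (m + n)).
Local Notation z := (@mixed_s m n).
Local Notation admissible := (@admissible Q m (m + n) z).

(** A right action, matching the left-to-right reading of words. Independence of the representative
    is known on admissible states. *)
Definition act (b : braid (m + n)) (st : state Q) : state Q :=
  run m z (repr b) st.

Let eqv := run_eqv (fun k l _ => @mixed_s_far m n k l) (@mixed_s_braid m n).

Lemma act_class w st : admissible st ->
  act (word_class (@braid_rel (m + n)) w) st = run m z w st.
Proof. by move=> adm; apply: eqv adm; apply: word_eqv_repr. Qed.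

Lemma actM b c st : admissible st -> act (b * c) st = act c (act b st).
Proof. by move=> adm; rewrite act_class // /run foldl_cat. Qed.

Lemma act1 st : admissible st -> act 1 st = st.
Proof. by move=> adm; rewrite act_class. Qed.

Lemma actV b st st' : admissible st' -> act b st' = st -> act b^-1 st = st'.
Proof. by move=> adm <-; rewrite -actM // mulgV act1. Qed.

Lemma act_sigma i st : 0 < i < m + n -> admissible st ->
  act (s i) st = step m z i true st.
Proof. by move=> iN adm; rewrite /sigma insubT act_class. Qed.

(* The first moving strand is at position [j.+1], the other ones at the right
   end. *)
Definition moved j : pred nat := fun p => (0 < p <= m.+1) && (p != j.+1).

Lemma moved_m : moved m = first_positions m.
Proof. by apply/funext => p; rewrite /moved /first_positions; lia. Qed.

Lemma count_moved j i : j <= m -> i <= m.+1 ->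
  count (moved j) (iota 1 i) = if i <= j then i else i.-1.
Proof.
move=> jm; elim: i => // i IHi im; rewrite countS IHi; last by lia.
by rewrite /moved; case: ifP; case: ifP; lia.
Qed.

Lemma admissible_moved j q : 0 < n -> j <= m ->
  admissible (moved j, core_loop m n, q).
Proof.
move=> n0 jm; split=> /=; first exact: core_loop_compatible.
have -> : m + n = m.+1 + n.-1 by lia.
rewrite iotaD count_cat count_moved // ifF; last lia.
rewrite (@eq_in_count _ _ pred0) ?count_pred0 ?addn0 // => p.
by rewrite mem_iota /moved /=; lia.
Qed.

Lemma swap_moved j : 0 < j -> j <= m -> swap_positions j (moved j) = moved j.-1.
Proof.
move=> j0 jm; apply/funext => p; rewrite /swap_positions /moved.
by do ?case: ifP; lia.
Qed.

Lemma step_moved j q : 0 < j -> j <= m ->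
  step m z j true (moved j, core_loop m n, q) = (moved j.-1, core_loop m n, q).
Proof.
move=> j0 jm; rewrite /step swap_moved //.
have -> : moved j j = true by rewrite /moved; lia.
have -> : moved j j.+1 = false by rewrite /moved; lia.
by rewrite /= mulg1.
Qed.

Lemma step_moved_pred j q : 0 < j -> j <= m ->
  step m z j true (moved j.-1, core_loop m n, q) =
  (moved j, core_loop m n, q * core_loop m n j).
Proof.
move=> j0 jm; rewrite /step -swap_moved // swap_positionsK swap_moved //.
have -> : moved j.-1 j = false by rewrite /moved; lia.
have -> : moved j.-1 j.+1 = true by rewrite /moved; lia.
rewrite count_moved ?leqnn; try lia.
by rewrite prednK //= (_ : m + j - j.-1 = m.+1) ?loop0 //; lia.
Qed.

(** Unfolded by [pure_a_right], the moving strand travels left past the fixed strands [j], ...,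
    [i.+1] at no cost, makes one full turn with strand [i], which contributes its loop, and returns
    the same way. For [j = m] this is the base state. *)
Lemma act_pure_a_moved i j q : 0 < n -> 0 < i -> i <= j -> j <= m ->
  act (a i j.+1) (moved j, core_loop m n, q) =
  (moved j, core_loop m n, q * core_loop m n i).
Proof.
move=> n0 i0; elim: j q => [|j IHj] q ij jm; first by lia.
have adm := admissible_moved _ n0.
have sj q' : act (s j.+1) (moved j.+1, core_loop m n, q') =
             (moved j, core_loop m n, q').
  by rewrite act_sigma ?step_moved //; [lia|apply: adm].
have [ij1|ij1] := eqVneq i j.+1.
  rewrite ij1 pure_a_adj actM ?sj; last exact: adm.
  rewrite act_sigma; [|lia|by apply: adm; lia].
  exact: (@step_moved_pred j.+1).
rewrite pure_a_right; try lia.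
rewrite conjgE invgK actM ?sj; last exact: adm.
rewrite actM ?IHj; [|lia|lia|by apply: adm; lia].
by apply: actV; [apply: adm|apply: sj].
Qed.

Local Notation base q := (first_positions m, core_loop m n, q).

Lemma admissible_base q : 0 < n -> admissible (base q).
Proof. by move=> n0; rewrite -moved_m; apply: admissible_moved. Qed.

Lemma act_base_sigma l q : m < l < m + n -> act (s l) (base q) = base (q * z l).
Proof.
move=> /andP[ml lN]; have n0 : 0 < n by lia.
rewrite act_sigma; [|lia|exact: admissible_base].
rewrite /step.
have -> : first_positions m l = false by rewrite /first_positions; lia.
have -> : first_positions m l.+1 = false by rewrite /first_positions; lia.
rewrite swap_positions_id; last by rewrite /first_positions; lia.
rewrite (@count_pred_interval _ m) //=; [|rewrite /first_positions; lia..].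
by rewrite addKn.
Qed.

Lemma act_base_pure_a i j q : 0 < i <= m -> m < j <= m + n ->
  act (a i j) (base q) = base (q * mixed_a m n i j).
Proof.
move=> /andP[i0 im]; elim: j q => [|j IHj] q mj; first by lia.
have n0 : 0 < n by lia.
have [<-|jm] := eqVneq m j.
  by rewrite -moved_m act_pure_a_moved.
have adm q' := admissible_base q' n0.
rewrite pure_a_right; try lia.
rewrite conjgE invgK actM ?act_base_sigma; [|lia|exact: adm].
rewrite actM ?IHj; [|lia|exact: adm].
apply: actV; first exact: adm.
rewrite act_base_sigma; last lia.
by rewrite mixed_a_right ?conjgE ?invgK ?gnorm //; lia.
Qed.

Lemma act_base_gen (x : mixed_gen m n) q : 0 < n ->
  act (mixed_gen_val x) (base q) = base (q * presented_gen R x).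
Proof.
move=> n0; case: x => [[[i j] /= aij]|[l sl]] /=.
  have [i0 im mj jN] := is_aP aij.
  by rewrite act_base_pure_a; [rewrite (mixed_aE aij)|lia..].
by rewrite act_base_sigma // (mixed_sE sl).
Qed.

Lemma act_base_eval (w : word (mixed_gen m n)) q : 0 < n ->
  act (eval_word (@mixed_gen_val m n) w) (base q) = base (q * word_class R w).
Proof.
move=> n0; have adm q' := admissible_base q' n0.
elim: w q => [|[x e] w IHw] q.
  by rewrite /eval_word big_nil act1 // word_class_nil mulg1.
rewrite /eval_word big_cons actM // word_class_cons mulgA -IHw; congr act.
case: e => /=; first exact: act_base_gen.
by apply: actV => //; rewrite act_base_gen // mulgVK.
Qed.

Lemma eval_mixed_inj (v w : word (mixed_gen m n)) : 0 < n ->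
  eval_word (@mixed_gen_val m n) v = eval_word (@mixed_gen_val m n) w ->
  word_class R v = word_class R w.
Proof.
move=> n0 vw; have := act_base_eval v 1 n0.
by rewrite vw act_base_eval // !mul1g => -[].
Qed.

End Action.

(** * The transversal *)

Section Transversal.
Variable k : nat.
Local Notation s := (sigma k).
Local Notation a := (pure_a k).

Definition shift r p : braid k := \prod_(r <= l < p) s l.

Lemma shift_geq r p : p <= r -> shift r p = 1.
Proof. by move=> pr; rewrite /shift big_geq. Qed.

Lemma shift_rcons r p : r <= p -> shift r p.+1 = shift r p * s p.
Proof. by move=> rp; rewrite /shift big_nat_recr. Qed.

Lemma shift_cons r p : r < p -> shift r p = s r * shift r.+1 p.
Proof. by move=> rp; rewrite /shift big_ltn. Qed.

Lemma commute_shift r p x :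
  (forall l, r <= l < p -> commute (s l) x) -> commute (shift r p) x.
Proof.
move=> sx; rewrite /shift big_nat_cond.
elim/big_rec: _ => [|l y lrp yx]; first exact/commute_sym/commute1.
by apply: commuteMl => //; apply: sx; lia.
Qed.

Lemma shift_conj r p l : 0 < r -> r <= l -> l.+1 < p -> p <= k ->
  s l ^ (shift r p)^-1 = s l.+1.
Proof.
move=> r0 rl; elim: p => // p IHp; rewrite ltnS leq_eqVlt => /orP[/eqP<-|lp] pk.
  rewrite !shift_rcons; [|lia..].
  rewrite -mulgA invgM conjgM.
  have -> : s l ^ (s l * s l.+1)^-1 = s l.+1.
    apply: (canLR (conjgK _)).
    by rewrite (braided_conj (esym (sigma_braid _ _))) //; lia.
  apply/conjg_commute/commuteV/commute_sym/commute_shift => q rq.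
  by apply: sigma_far; lia.
rewrite shift_rcons; last lia.
rewrite invgM conjgM (@conjg_commute _ (s l)) ?IHp //; try lia.
by apply/commuteV/sigma_far.
Qed.

Lemma shift_shift r p q : 0 < r -> q < p -> p <= k ->
  shift r q ^ (shift r p)^-1 = shift r.+1 q.+1.
Proof.
move=> r0; elim: q => [|q IHq] qp pk.
  by rewrite (@shift_geq r 0) // (@shift_geq _ 1) ?conj1g.
have [qr|rq] := ltnP q r.
  by rewrite (@shift_geq r q.+1) // (@shift_geq r.+1) ?conj1g.
rewrite (@shift_rcons r q) // conjMg IHq; [|lia..].
by rewrite shift_conj -?shift_rcons //; lia.
Qed.

(** Both sides are the same half-twist of the strands at [r] and [p.+1]; the induction turns over
    one letter at a time by [braided_conjV]. *)
Lemma shift_end r p : 0 < r -> r <= p -> p < k ->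
  s p ^ (shift r p)^-1 = s r ^ shift r.+1 p.+1.
Proof.
move=> r0; elim: p => [|p IHp] rp pk; first by lia.
move: rp; rewrite leq_eqVlt => /orP[/eqP<-|rp].
  by rewrite !shift_geq // invg1 !conjg1.
rewrite shift_rcons // invgM conjgM.
rewrite -(braided_conjV (sigma_braid _ _)); try lia.
rewrite conjJg IHp; try lia.
rewrite (@conjg_commute _ (s p.+1)); last first.
  apply/commuteV/commute_sym/commute_shift => q rq.
  by apply: sigma_far; lia.
by rewrite -conjgM -shift_rcons.
Qed.

(* Carries the strands at the positions 1, ..., m to the positions in [K], the
   last one first; the fixed strands all pass on the same side of the moving
   ones and do not cross each other. *)
Fixpoint spread (K : pred nat) p : braid k :=
  if p is p'.+1 then
    if K p then shift (count K (iota 1 p')).+1 p * spread K p' else spread K p'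
  else 1.

Lemma commute_spread K p l : p < l -> commute (spread K p) (s l).
Proof.
elim: p => [|p IHp] pl /=; first exact/commute_sym/commute1.
have IH : commute (spread K p) (s l) by apply: IHp; lia.
case: ifP => // _; apply: commuteMl => //; apply: commute_shift => q qp.
by apply: sigma_far; lia.
Qed.

Lemma eq_spread K K' p : (forall q, 0 < q <= p -> K q = K' q) ->
  spread K p = spread K' p.
Proof.
elim: p => // p IHp KK' /=; rewrite -KK' ?IHp ?leqnn //; last first.
  by move=> q qp; apply: KK'; lia.
rewrite (@eq_in_count _ _ K') // => q; rewrite mem_iota => qp.
by apply: KK'; lia.
Qed.

Lemma spread_pred K i : 0 < i -> spread K i.+1 =
  (if K i.+1 then shift (count K (iota 1 i.-1) + K i).+1 i.+1 else 1) *
  ((if K i then shift (count K (iota 1 i.-1)).+1 i else 1) * spread K i.-1).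
Proof.
case: i => // j _.
have -> : spread K j.+2 =
  if K j.+2 then shift (count K (iota 1 j.+1)).+1 j.+2 * spread K j.+1
  else spread K j.+1 by [].
rewrite countS /=; case: (K j.+2); case: (K j.+1); by rewrite ?mul1g.
Qed.

(** * Schreier elements of the four kinds of crossings *)

Section Crossing.
Variables (K : pred nat) (i : nat).
Hypothesis i0 : 0 < i.
Local Notation c := (count K (iota 1 i.-1)).

Let pred_commute : commute (spread K i.-1) (s i).
Proof. by apply: commute_spread; lia. Qed.

(** The paths of the two fixed strands cancel by [shift_end], leaving the crossing of their ranks.
    Each later fixed strand adds a shift that starts beyond this crossing and commutes with it. *)
Lemma spread_fixed p : K i -> K i.+1 -> i < p -> p <= k ->
  s i ^ (spread K p)^-1 = s c.+1.
Proof.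
move=> Ki Ki1; elim: p => // p IHp.
rewrite ltnS leq_eqVlt => /orP[/eqP<-|ip] pk.
  rewrite spread_pred // Ki Ki1 addn1 mulgA invgM conjgM.
  rewrite (@conjg_commute _ (s i)); last exact/commuteV/commute_sym.
  have ci := count_iota_size K i.-1.
  rewrite invgM conjgM shift_end //; last lia.
  by rewrite conjgK.
rewrite /=; case: ifP => _; last by apply: IHp => //; lia.
rewrite invgM conjgM IHp //; last lia.
apply/conjg_commute/commuteV/commute_sym/commute_shift => q.
have := @count_iota_le K i.+1 p ip; rewrite countS (count_lt K i0) Ki Ki1.
by move=> ? ?; apply/commute_sym/sigma_far; lia.
Qed.

(** Every fixed strand to the right of the crossing is pulled past it to the left and raises the
    index by one, by [shift_conj]. *)
Lemma spread_moving p : ~~ K i -> ~~ K i.+1 -> i < p -> p <= k ->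
  s i ^ (spread K p)^-1 = s (i + count K (iota 1 p) - c).
Proof.
move=> /negPf Ki /negPf Ki1; have := count_iota_size K i.-1 => ci.
elim: p => // p IHp; rewrite ltnS leq_eqVlt => /orP[/eqP<-|ip] pk.
  rewrite spread_pred // countS (count_lt K i0) Ki Ki1 !addn0 !mul1g addnK.
  exact/conjg_commute/commuteV/commute_sym.
have := @count_iota_le K i.+1 p ip; rewrite countS (count_lt K i0) Ki Ki1 => cp.
rewrite countS /=; case: ifP => _; last by rewrite addn0 IHp //; lia.
by rewrite invgM conjgM IHp ?shift_conj; try (congr s); lia.
Qed.

Lemma spread_swap p : K i -> ~~ K i.+1 -> i < p ->
  spread K p * s i = spread (swap_positions i K) p.
Proof.
move=> Ki /negPf Ki1; elim: p => // p IHp.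
rewrite ltnS leq_eqVlt => /orP[/eqP<-|ip].
  rewrite !spread_pred // swap_positions_l swap_positions_r Ki Ki1 !mul1g.
  have ci := count_iota_size K i.-1.
  rewrite count_swap_lt ?addn0 -?mulgA ?pred_commute; last lia.
  rewrite mulgA -shift_rcons; last lia.
  congr (_ * _); apply: eq_spread => q qi; rewrite swap_positions_out //; lia.
rewrite /= swap_positions_out; try lia.
rewrite count_swap ?i0 //; case: ifP => _; last exact: IHp.
by rewrite -mulgA IHp.
Qed.

(** A fixed strand further right lengthens the loop by one strand: the first letter of its shift
    turns a_{c+1,d+1} into a_{c+1,d+2}, and the remaining letters only translate the conjugating
    shift. *)
Lemma spread_loop p : K i -> ~~ K i.+1 -> i < p -> p <= k ->
  (s i * s i) ^ (spread K p)^-1 = a c.+1 (count K (iota 1 p)).+1 ^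
    shift (count K (iota 1 p)).+1 (i + count K (iota 1 p) - c).
Proof.
move=> Ki /negPf Ki1; have := count_iota_size K i.-1 => ci.
elim: p => // p IHp; rewrite ltnS leq_eqVlt => /orP[/eqP<-|ip] pk.
  rewrite spread_pred // countS (count_lt K i0) Ki Ki1 addn0 addn1 mul1g.
  rewrite invgM conjgM (@conjg_commute _ (s i * s i)); last first.
    by apply/commuteV/commuteMl; apply: commute_sym.
  rewrite conjMg shift_end; try lia.
  by rewrite -conjMg pure_a_adj (_ : i + c.+1 - c = i.+1) //; lia.
have := @count_iota_le K i.+1 p ip; rewrite countS (count_lt K i0) Ki Ki1 => cp.
have := count_iota_size K p => dp.
rewrite countS /=; case: ifP => Kp; last by rewrite addn0 IHp //; lia.
rewrite invgM conjgM IHp // ?addn1; last lia.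
set d := count K (iota 1 p) in cp dp *.
rewrite conjJg shift_shift; try lia.
rewrite (_ : i + d.+1 - c = (i + d - c).+1); last lia.
congr (_ ^ _); rewrite shift_cons; last lia.
rewrite invgM conjgM (@conjg_commute _ (a _ _)); last first.
  apply/commuteV/commute_sym/commute_shift => q qp.
  by apply/commute_sym/pure_a_far; lia.
by rewrite -pure_a_right //; lia.
Qed.

End Crossing.
End Transversal.

(** * The image *)

Section Image.
Variables m n : nat.
Local Notation s := (sigma (m + n)).
Local Notation a := (pure_a (m + n)).
Local Notation bword := (word (braid_gen (m + n))).
Local Notation bclass := (word_class (@braid_rel (m + n))).

Definition in_image (x : braid (m + n)) : Prop :=
  exists w, x = eval_word (@mixed_gen_val m n) w.

Lemma in_image1 : in_image 1.
Proof. by exists [::]; rewrite /eval_word big_nil. Qed.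

Lemma in_imageM x y : in_image x -> in_image y -> in_image (x * y).
Proof.
by case=> [u ->] [v ->]; exists (u ++ v); rewrite /eval_word big_cat.
Qed.

Lemma in_image_gen x e : in_image (literal e (mixed_gen_val x)).
Proof. by exists [:: (x, e)]; rewrite /eval_word big_seq1. Qed.

Lemma in_image_eval (P : braid (m + n) -> Prop) :
  P 1 -> (forall x y, P x -> P y -> P (x * y)) ->
  (forall x e, P (literal e (mixed_gen_val x))) ->
  forall x, in_image x -> P x.
Proof.
move=> P1 PM Pgen _ [w ->]; elim: w => [|[x e] w IHw].
  by rewrite /eval_word big_nil.
by rewrite /eval_word big_cons; apply: PM.
Qed.

Lemma in_imageV x : in_image x -> in_image x^-1.
Proof.
move: x; apply: in_image_eval => [|x y IHx IHy|x e].
- by rewrite invg1; apply: in_image1.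
- by rewrite invgM; apply: in_imageM.
by rewrite -literalN; apply: in_image_gen.
Qed.

Lemma in_image_literal e x : in_image x -> in_image (literal e x).
Proof. by case: e => //; apply: in_imageV. Qed.

Lemma in_imageJ x y : in_image x -> in_image y -> in_image (x ^ y).
Proof.
by move=> xi yi; rewrite conjgE; do ?apply: in_imageM => //; apply: in_imageV.
Qed.

Lemma in_image_sigma l : m < l -> in_image (s l).
Proof.
move=> ml; have [lN|Nl] := ltnP l (m + n).
  have sl : is_s m n l by apply/andP.
  exact: (in_image_gen (gen_s sl) true).
by rewrite /sigma insubF; [apply: in_image1 | lia].
Qed.

Lemma in_image_pure_a i j : 0 < i <= m -> m < j <= m + n -> in_image (a i j).
Proof.
move=> im mj; have aij : is_a m n i j by apply/andP.
exact: (in_image_gen (gen_a aij) true).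
Qed.

Lemma in_image_shift r p : m < r -> in_image (shift (m + n) r p).
Proof.
move=> mr; have [rp|pr] := ltnP r p; last first.
  by rewrite shift_geq //; apply: in_image1.
elim: p rp => // p IHp; rewrite ltnS leq_eqVlt => /orP[/eqP<-|rp].
  by rewrite shift_rcons // shift_geq // mul1g; apply: in_image_sigma.
rewrite shift_rcons; last lia.
by apply: in_imageM; [apply: IHp | apply: in_image_sigma; lia].
Qed.

Lemma pure_a_braid4_left i j : 0 < i -> i.+1 < j -> j <= m + n ->
  braided4 (a i.+1 j) (s i).
Proof.
move=> i0; elim: j => // j IHj; rewrite ltnS leq_eqVlt => /orP[/eqP<-|ij] jN.
  by rewrite pure_a_adj; apply/braided4_sq/esym/sigma_braid; lia.
rewrite pure_a_right; try lia.
rewrite -[s i](@conjg_commute _ _ (s j)^-1).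
  by apply/braided4J/IHj; lia.
by apply/commuteV/sigma_far; lia.
Qed.

(** Only r = i and r = i + 1 are affected. Conjugation by sigma_i sends a_{i+1,j} to a_{ij}, and
    a_{ij} to the conjugate of a_{i+1,j} by a_{ij}^-1; its inverse sends a_{ij} to a_{i+1,j}, and
    a_{i+1,j} to the conjugate of a_{ij} by a_{i+1,j}. *)
Lemma in_imageJ_sigma i e x : 0 < i < m ->
  in_image x -> in_image (x ^ literal e (s i)).
Proof.
move=> /andP[i0 im]; move: x; apply: in_image_eval => [|x y IHx IHy|x e'].
- by rewrite conj1g; apply: in_image1.
- by rewrite conjMg; apply: in_imageM.
rewrite -literalJ; apply: in_image_literal.
have com : commute (mixed_gen_val x) (s i) ->
    in_image (mixed_gen_val x ^ literal e (s i)).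
  move=> xs; rewrite conjg_commute; first exact: (in_image_gen x true).
  by case: e => //; apply: commuteV.
case: x com => [[[r j] /= arj]|[l /= /andP[ml lN]]] com; last first.
  by apply: com; apply/commute_sym/sigma_far; lia.
have [r0 rm mj jN] := is_aP arj.
have [ri|ri] := ltnP r i; first by apply: com; apply: pure_a_inner; lia.
have [ri1|ri1] := ltnP i.+1 r; first by apply: com; apply: pure_a_far_left; lia.
have im1 : in_image (a i.+1 j) by apply: in_image_pure_a; lia.
have im0 : in_image (a i j) by apply: in_image_pure_a; lia.
have br : braided4 (a i.+1 j) (s i) by apply: pure_a_braid4_left; lia.
have aE : a i j = a i.+1 j ^ s i by apply: pure_a_left; lia.
have [->|nri] := eqVneq r i.
  case: e {com} => /=; last by rewrite aE conjgK.
  rewrite aE conjg_sq_braided4 // -aE.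
  by apply: in_imageJ => //; apply: in_imageV.
have -> : r = i.+1 by lia.
case: e {com} => /=; first by rewrite -aE.
have -> : a i.+1 j ^ (s i)^-1 = a i j ^ a i.+1 j.
  by rewrite aE -(proj1 (braided4_conjV _ _) br) -conjgM mulgVK.
exact: in_imageJ.
Qed.

(** A relation with a witness word is enough, as [mixed_braid] itself asks for one representing
    word; invariance of strand removal under the Artin relations is thereby bypassed. *)
Definition traces (K : pred nat) (x : braid (m + n)) (K' : pred nat)
    (b : braid m) : Prop :=
  exists w : bword,
    [/\ x = bclass w, positions_after w K = K' & remove_strands m w K = b].

Lemma positions_after_cat (u v : bword) K :
  positions_after (u ++ v) K = positions_after v (positions_after u K).
Proof. by elim: u K => //= -[x e] u IHu K. Qed.

Lemma remove_strands_cat (u v : bword) K : remove_strands m (u ++ v) K =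
  remove_strands m u K * remove_strands m v (positions_after u K).
Proof.
by elim: u K => [|[x e] u IHu] K /=; rewrite ?mul1g // IHu mulgA.
Qed.

Lemma traces1 K : traces K 1 K 1.
Proof. by exists [::]. Qed.

Lemma tracesM K x K' b y K'' c :
  traces K x K' b -> traces K' y K'' c -> traces K (x * y) K'' (b * c).
Proof.
case=> [u [-> <- <-]] [v [-> <- <-]]; exists (u ++ v).
by rewrite word_class_cat positions_after_cat remove_strands_cat.
Qed.

Definition crossing i K : braid m :=
  if K i && K i.+1 then sigma m (count K (iota 1 i)) else 1.

Lemma remove_strands_cons y e (w : bword) K : remove_strands m ((y, e) :: w) K =
  literal e (crossing (val y) K) *
  remove_strands m w (swap_positions (val y) K).
Proof.
by rewrite /= /crossing; case: ifP => _ //; case: e; rewrite //= invg1.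
Qed.

Lemma traces_sigma i e K : 0 < i < m + n ->
  traces K (literal e (s i)) (swap_positions i K) (literal e (crossing i K)).
Proof.
move=> iN; exists [:: (exist _ i iN, e)]; split=> //.
  by rewrite word_class_letter /sigma insubT.
rewrite /= mulg1 /crossing; case: ifP => _ //.
by case: e; rewrite //= invg1.
Qed.

Lemma crossing_swap i K :
  0 < i -> crossing i (swap_positions i K) = crossing i K.
Proof.
move=> i0; rewrite /crossing swap_positions_l swap_positions_r andbC.
case: ifP => // /andP[Ki Ki1]; rewrite swap_positions_id //.
by rewrite Ki Ki1.
Qed.

Lemma tracesV K x K' b : traces K x K' b -> traces K' x^-1 K b^-1.
Proof.
case=> [w [-> <- <-]] {K' b x}; elim: w K => [|[y e] w IHw] K.
  by rewrite word_class_nil !invg1; apply: traces1.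
have iN := valP y; have [i0 _] := andP iN.
rewrite word_class_cons -sigmaE.
rewrite remove_strands_cons.
rewrite !invgM; apply: tracesM; first exact: IHw.
have := traces_sigma (~~ e) (swap_positions (val y) K) iN.
by rewrite !literalN crossing_swap // swap_positionsK.
Qed.

Local Notation pure x K := (traces K x K 1).

Lemma pure_conj_sigma i e x K : 0 < i < m + n -> crossing i K = 1 ->
  pure x (swap_positions i K) -> pure (x ^ (literal e (s i))^-1) K.
Proof.
move=> iN K1 xp; rewrite conjgE invgK mulgA.
have si := traces_sigma e K iN; have l1 : literal e (crossing i K) = 1.
  by rewrite K1; case: e {si}; rewrite //= invg1.
rewrite l1 in si; rewrite -[1]mulg1 -{1}[1]mulg1 -{3}invg1.
by apply: tracesM (tracesV si); apply: tracesM si xp.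
Qed.

Lemma crossing_moved j : crossing j (moved m j) = 1.
Proof. by rewrite /crossing /moved eqxx andbF andbF. Qed.

(** Every crossing on the way involves the moving strand, so none survives the removal. *)
Lemma pure_core_loop i j : 0 < n -> 0 < i -> i <= j -> j <= m ->
  pure (a i j.+1) (moved m j).
Proof.
move=> n0 i0; elim: j => [|j IHj] ij jm; first by lia.
have [<-|ij1] := eqVneq i j.+1.
  have iN : 0 < i < m + n by lia.
  have si := traces_sigma true (moved m i) iN.
  have si' := traces_sigma true (swap_positions i (moved m i)) iN.
  rewrite crossing_swap // swap_positionsK /= in si'.
  rewrite /= crossing_moved in si si'.
  by rewrite pure_a_adj -[1]mulg1; apply: tracesM si si'.
rewrite pure_a_right; try lia.
apply: (@pure_conj_sigma _ true); [lia|exact: crossing_moved|].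
by rewrite swap_moved //; apply: IHj; lia.
Qed.

Lemma pure_sigma l : m < l < m + n -> pure (s l) (first_positions m).
Proof.
move=> lN; have l0N : 0 < l < m + n by lia.
have := traces_sigma true (first_positions m) l0N.
rewrite swap_positions_id /crossing /first_positions; last by lia.
by rewrite ifF //; lia.
Qed.

Lemma pure_pure_a i j : 0 < i <= m -> m < j <= m + n ->
  pure (a i j) (first_positions m).
Proof.
move=> /andP[i0 im]; elim: j => [|j IHj] mj; first by lia.
have [<-|jm] := eqVneq m j.
  by rewrite -moved_m; apply: pure_core_loop; lia.
rewrite pure_a_right; try lia.
apply: (@pure_conj_sigma _ true); [lia| |].
  by rewrite /crossing /first_positions ifF //; lia.
rewrite swap_positions_id; last by rewrite /first_positions; lia.
by apply: IHj; lia.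
Qed.

Lemma in_image_mixed x : in_image x -> @mixed_braid m n x.
Proof.
move=> xi; suff: pure x (first_positions m).
  by case=> w [? E ?]; exists w; split=> //; rewrite E.
move: x xi; apply: in_image_eval => [|y z yp zp|y e]; first exact: traces1.
  by rewrite -[X in traces _ _ _ X]mulg1; apply: tracesM yp zp.
have yp : pure (mixed_gen_val y) (first_positions m).
  case: y => [[[i j] /= aij]|[l sl]]; last exact: pure_sigma.
  by have [i0 im mj jN] := is_aP aij; apply: pure_pure_a; lia.
by case: e => //=; rewrite -[X in traces _ _ _ X]invg1; apply: tracesV.
Qed.

Lemma word_class_ind (k : nat) (P : braid k -> Prop) : P 1 ->
  (forall i e x, 0 < i < k -> P x -> P (literal e (sigma k i) * x)) ->
  forall x, P x.
Proof.
move=> P1 Ps x; rewrite -[x]word_class_repr.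
elim: (repr x) => [|[i e] w IHw] //.
by rewrite word_class_cons -sigmaE; apply: Ps => //; exact: (valP i).
Qed.

(** Adding [n] trivial strands on the right. It carries the braid left after strand removal back
    into the large group, where the factorization takes place. *)
Lemma fixed_strands_inclusion :
  exists incl : UMagmaMorphism.type (braid m) (braid (m + n)),
    forall i, 0 < i < m -> incl (sigma m i) = s i.
Proof.
have [|incl inclE] := @presented_lift _ (@braid_rel m) _ (fun x => s (val x)).
  move=> u v uv; case: uv => {u v} [[i im] [j jm]|[i im] [j jm]] /= ij;
    rewrite /eval_word !big_cons !big_nil /= !mulg1.
    by case/orP: ij => ij; [|symmetry]; apply: sigma_far.
  by rewrite ij !mulgA; apply: sigma_braid; lia.
exists incl => i im; rewrite {1}/sigma insubT /presented_gen inclE.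
by rewrite /eval_word big_seq1.
Qed.

(** * Factorization along a word through the transversal *)

Section Factorization.
Variable incl : UMagmaMorphism.type (braid m) (braid (m + n)).
Hypothesis inclE : forall i, 0 < i < m -> incl (sigma m i) = s i.
Local Notation spread K := (spread (m + n) K (m + n)).

Lemma in_imageJ_inclusion b x : in_image x -> in_image (x ^ incl b).
Proof.
move: b x; apply: word_class_ind => [x|i e b im IHb x xi].
  by rewrite gmulf1 conjg1.
rewrite gmulfM conjgM; apply: IHb.
have -> : incl (literal e (sigma m i)) = literal e (s i).
  by case: e; rewrite /= ?gmulfV inclE.
exact: in_imageJ_sigma.
Qed.

Lemma factor_letter i e K : 0 < i < m + n -> count K (iota 1 (m + n)) = m ->
  exists2 h, in_image h & spread K * literal e (s i) =
    incl (literal e (crossing i K)) * h * spread (swap_positions i K).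
Proof.
move=> /andP[i0 iN] Km.
(* In three of the four kinds of crossings no fixed strands cross each other, so the factor from
   [incl] is trivial. *)
have wit h : in_image h -> spread K * literal e (s i) =
    h * spread (swap_positions i K) -> crossing i K = 1 ->
  exists2 h, in_image h & spread K * literal e (s i) =
    incl (literal e (crossing i K)) * h * spread (swap_positions i K).
  move=> hi hE ->; exists h => //.
  by rewrite hE; case: e {hE}; rewrite /= ?invg1 gmulf1 mul1g.
have conjE x g : g * x = x ^ g^-1 * g :> braid (m + n) by rewrite conjgE !gnorm.
have cm := @count_iota_le K i.+1 (m + n) iN.
rewrite countS (count_lt K i0) Km in cm.
have ci := count_iota_size K i.-1.
have loop_in (K' : pred nat) :
    K' i -> ~~ K' i.+1 -> count K' (iota 1 (m + n)) = m ->
    in_image ((s i * s i) ^ (spread K')^-1).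
  move=> Ki Ki1 Km'; rewrite spread_loop // Km'.
  have cm' := @count_iota_le K' i.+1 (m + n) iN.
  rewrite countS (count_lt K' i0) Km' Ki (negPf Ki1) in cm'.
  have ci' := count_iota_size K' i.-1.
  apply: in_imageJ; last exact: in_image_shift.
  by apply: in_image_pure_a; lia.
have [Ki|Ki] := boolP (K i); have [Ki1|Ki1] := boolP (K i.+1).
- exists 1; first exact: in_image1.
  rewrite swap_positions_id ?Ki ?Ki1 // mulg1 /crossing Ki Ki1 /=.
  rewrite conjE // -literalJ spread_fixed //; congr (_ * _).
  rewrite (count_lt K i0) Ki addn1.
  rewrite Ki Ki1 in cm.
  by case: e {wit}; rewrite /= ?gmulfV inclE //; lia.
- have cr : crossing i K = 1 by rewrite /crossing (negPf Ki1) andbF.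
  case: e wit => wit.
    by apply: (wit 1) => //=; [apply: in_image1 | rewrite spread_swap // mul1g].
  (* The positive crossing leads from one transversal element to the next, so the negative one
     differs from it by the square of sigma_i. *)
  apply: (wit ((s i * s i) ^ (spread K)^-1)^-1) => //=.
    by apply: in_imageV; apply: loop_in.
  by rewrite -spread_swap // -conjVg conjgE !gnorm.
- have cr : crossing i K = 1 by rewrite /crossing (negPf Ki).
  have K'i : swap_positions i K i by rewrite swap_positions_l.
  have K'i1 : ~~ swap_positions i K i.+1 by rewrite swap_positions_r.
  have KE : spread (swap_positions i K) * s i = spread K.
    by rewrite spread_swap // swap_positionsK.
  case: e wit => wit; last first.
    by apply: (wit 1) => //=; [apply: in_image1 | rewrite -KE mulgK mul1g].
  (* Here the transversal element of the swapped positions comes before that of [K], and it is the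
     positive crossing that completes the full turn. *)
  apply: (wit ((s i * s i) ^ (spread (swap_positions i K))^-1)) => //=.
    by apply: loop_in => //; rewrite count_swap // i0.
  by rewrite -KE conjgE !gnorm.
have cr : crossing i K = 1 by rewrite /crossing (negPf Ki).
apply: (wit (literal e (s (i + m - count K (iota 1 i.-1))))) => //.
  by apply/in_image_literal/in_image_sigma; lia.
rewrite swap_positions_id ?(negPf Ki) ?(negPf Ki1) //.
by rewrite conjE // -literalJ spread_moving // Km.
Qed.

Lemma factor_word (w : bword) K : count K (iota 1 (m + n)) = m ->
  exists2 h, in_image h & spread K * bclass w =
    incl (remove_strands m w K) * h * spread (positions_after w K).
Proof.
elim: w K => [|[x e] w IHw] K Km.
  by exists 1; [apply: in_image1 | rewrite gmulf1 !mulg1 mul1g].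
have xN := valP x; have [h hi hE] := factor_letter e xN Km.
have [|h' hi' hE'] := IHw (swap_positions (val x) K).
  by case/andP: xN => x0 xN; rewrite -[RHS]Km; apply: count_swap; rewrite x0.
rewrite word_class_cons -sigmaE mulgA hE -mulgA hE'.
rewrite remove_strands_cons gmulfM /=.
(* The factor [h] is moved to the right past the braid of the fixed strands contributed by the rest
   of the word, which is where normality enters. *)
exists (h ^ incl (remove_strands m w (swap_positions (val x) K)) * h').
  by apply: in_imageM => //; apply: in_imageJ_inclusion.
by rewrite conjgE !gnorm.
Qed.

End Factorization.

Lemma spread_first_positions p :
  m <= p -> spread (m + n) (first_positions m) p = 1.
Proof.
have first c : c <= m -> count (first_positions m) (iota 1 c) = c.
  move=> cm; apply: count_pred_interval => // q.
  by rewrite /first_positions; lia.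
suff low c : c <= m -> spread (m + n) (first_positions m) c = 1.
  elim: p => [|p IHp] mp; first by [].
  have [<-|pm] := eqVneq m p.+1; first exact: low.
  rewrite /= ifF; last by rewrite /first_positions; lia.
  by apply: IHp; lia.
elim: c => // c IHc cm /=; rewrite IHc; last lia.
rewrite first; last lia.
by rewrite shift_geq // mul1g if_same.
Qed.

Lemma mixed_in_image x : @mixed_braid m n x -> in_image x.
Proof.
case=> w [-> pos rem]; have [incl inclE] := fixed_strands_inclusion.
have Kw : positions_after w (first_positions m) = first_positions m.
  exact/funext.
have [|h hi] := @factor_word incl inclE w (first_positions m).
  apply: count_pred_interval; rewrite ?leq_addr // => p.
  by rewrite /first_positions; lia.
(* The fixed braid and the transversal elements at both ends are trivial, so the braid equals the
   factor [h]. *)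
by rewrite rem Kw spread_first_positions ?leq_addr // gmulf1 !mul1g mulg1 => ->.
Qed.

End Image.

Theorem theorem2 (m n : nat) (hm : 1 <= m) (hn : 1 <= n) :
  has_presentation (@mixed_rel m n) (@mixed_braid m n) (@mixed_gen_val m n).
Proof.
have [phi phiE] := presented_lift (@mixed_gen_val_rel m n).
exists phi; split=> [x|x y|].
- by rewrite /presented_gen phiE /eval_word big_seq1.
- rewrite -[x]word_class_repr -[y]word_class_repr !phiE.
  exact: eval_mixed_inj.
apply/seteqP; split=> [_ [x _ <-]|x /mixed_in_image[w ->]].
  rewrite -[x]word_class_repr phiE; apply: in_image_mixed.
  by exists (repr x).
by exists (word_class (@mixed_rel m n) w); [|apply: phiE].
Qed.
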